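(* Let $M \subset \mathbb{R}^q$ be compact and let $f_\mu : \mathbb{R}^p \to \mathbb{R}^p$, $\mu \in M$, be a family of maps that varies continuously in phase space and in $\mu$. Suppose that for each $\mu \in M$ the map $f_\mu$ has an attractor $\mathcal{A}_\mu$, and let $r_\mu > 0$ be such that $d_a(f_\mu^n(x), \mathcal{A}_\mu) \to 0$ as $n \to \infty$ for all $x \in B_{r_\mu}(\mathcal{A}_\mu)$. Suppose that: (A1) there exists a compact set $\Omega \subset \mathbb{R}^p$ such that $B_{r_\mu}(\mathcal{A}_\mu) \subseteq \Omega$ for all $\mu \in M$; (A2) for all $\mu \in M$ there exists a compact set $N_\mu \subseteq \Omega$, continuous with respect to $\mu$ in the Hausdorff metric, such that $f_\mu(N_\mu) \subseteq N_\mu$ and $\mathcal{A}_\mu = \mathrm{cl}\left( \bigcap_{n=0}^\infty f_\mu^n(N_\mu) \right)$. If $d_H\left( f_\mu^n(N_\mu), \mathcal{A}_\mu \right) \to 0$ as $n \to \infty$ uniformly in $\mu \in M$, then $\mathcal{A}_\mu$ is continuous in the Hausdorff metric in $M$.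
   Context: Let $d$ be a metric on $\mathbb{R}^p$ (inducing the usual topology). For $X, Y \subseteq \mathbb{R}^p$ put $d_a(X,Y) = \sup_{x \in X} \inf_{y \in Y} d(x,y)$, $d_H(X,Y) = \max[d_a(X,Y), d_a(Y,X)]$, and $B_r(X) = \{ y \in \mathbb{R}^p : d_a(y,X) \le r \}$, where $d_a(y,X)$ means $d_a(\{y\},X)$. Attractor: for a continuous map $f$ on $\mathbb{R}^p$, a (nonempty) compact set $\mathcal{A} \subset \mathbb{R}^p$ is an attractor of $f$ if (i) $f(\mathcal{A}) = \mathcal{A}$; (ii) $\mathcal{A}$ contains a dense orbit; (iii) there exists $r>0$ such that $d_a(f^n(x), \mathcal{A}) \to 0$ as $n \to \infty$ for all $x \in B_r(\mathcal{A})$. ''The family $f_\mu$ varies continuously in phase space and in $\mu$'' means that $(\mu,x) \mapsto f_\mu(x)$ is continuous on $M \times \mathbb{R}^p$. A family of compact sets $S_\mu$, $\mu \in M$, is continuous in the Hausdorff metric at $\mu \in M$ if for all $\varepsilon>0$ there is $\delta>0$ such that $d_H(S_\mu,S_\nu)<\varepsilon$ whenever $\nu \in M$ and $|\mu-\nu|<\delta$; it is continuous in $M$ if this holds at every $\mu \in M$. *)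

(* Defs.v *)
From mathcomp Require Import all_boot all_order all_algebra.
From mathcomp Require Import all_classical all_reals all_analysis.
Import Order.TTheory GRing.Theory Num.Theory.
Import numFieldNormedType.Exports.

Set Implicit Arguments.
Unset Strict Implicit.
Unset Printing Implicit Defensive.

Local Open Scope classical_set_scope.
Local Open Scope ring_scope.

Definition is_metric (R : realType) (T : Type) (d : T -> T -> R) : Prop :=
  [/\ forall x y, 0 <= d x y,
      forall x y, d x y = 0 <-> x = y,
      forall x y, d x y = d y x
    & forall x y z, d x z <= d x y + d y z].

Definition induces_topology (R : realType) (T : topologicalType)
    (d : T -> T -> R) : Prop :=
  forall (x : T) (U : set T),
    nbhs x U <-> exists2 e : R, 0 < e & [set y | d x y < e] `<=` U.

(* The suprema and infima are taken in the extended reals: on nonempty bounded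
   sets they are the real ones, while unbounded sets give +oo and not a junk
   value. *)
Definition d_a (R : realType) (T : Type) (d : T -> T -> R)
    (X Y : set T) : \bar R :=
  ereal_sup [set ereal_inf [set (d x y)%:E | y in Y] | x in X].

Definition d_H (R : realType) (T : Type) (d : T -> T -> R)
    (X Y : set T) : \bar R :=
  maxe (d_a d X Y) (d_a d Y X).

Definition nbhd (R : realType) (T : Type) (d : T -> T -> R)
    (r : R) (X : set T) : set T :=
  [set y | (d_a d [set y] X <= r%:E)%E].

Definition attracts (R : realType) (T : Type) (d : T -> T -> R)
    (f : T -> T) (A : set T) (r : R) : Prop :=
  forall x, nbhd d r A x -> d_a d [set iter n f x] A @[n --> \oo] --> 0%E.

Definition forward_orbit (T : Type) (f : T -> T) (x : T) : set T :=
  [set iter n f x | n in setT].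

Definition is_attractor (R : realType) (T : topologicalType)
    (d : T -> T -> R) (f : T -> T) (A : set T) : Prop :=
  [/\ A !=set0,
      compact A,
      f @` A = A,
      exists x, forward_orbit f x `<=` A /\ A `<=` closure (forward_orbit f x)
    & exists2 r : R, 0 < r & attracts d f A r].

(* `|mu - nu| is the max norm on R^q; by equivalence of norms the Euclidean one
   gives the same notion. *)
Definition hausdorff_continuous (R : realType) (q : nat) (T : Type)
    (d : T -> T -> R) (M : set 'rV[R]_q) (S : 'rV[R]_q -> set T) : Prop :=
  forall mu, M mu -> forall e : R, 0 < e ->
    exists2 delta : R, 0 < delta &
      forall nu, M nu -> `|mu - nu| < delta -> (d_H d (S mu) (S nu) < e%:E)%E.

(* Main.v *)
Require Import Defs.
From mathcomp Require Import all_boot all_order all_algebra.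
From mathcomp Require Import all_classical all_reals all_analysis.
From mathcomp Require Import lra.
Import Order.TTheory GRing.Theory Num.Theory.
Import numFieldNormedType.Exports.

Set Implicit Arguments.
Unset Strict Implicit.

Local Open Scope classical_set_scope.
Local Open Scope ring_scope.

(** The sets [iter n (f mu) @` N mu] approximate [A mu] in the Hausdorff
    distance, uniformly in [mu], so it suffices that for each fixed [n] they
    depend continuously on [mu]: a uniform limit of continuous families is
    continuous.  Continuity for fixed [n] follows by induction from
    [hausdorff_continuous_image]: applying a jointly continuous family of maps
    to a Hausdorff continuous family of compact sets gives such a family again.
    The reason is that near a compact set joint continuity is uniform
    ([uniform_continuity_near_compact]), so that if [x] in [S mu] and [y] in
    [S nu] are close, and [nu] is close to [mu], then [f mu x] and [f nu y] are
    close, with one modulus for all pairs.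

    The extended-real suprema and infima are eliminated at the start:
    [d_H d X Y < e] is traded for the statement that every point of either set
    has a point of the other within distance [e]
    ([near_each_of_d_H_lt], [d_H_lt_of_near_each]). *)

(** For [d_a d X Y < e] this is only a necessary condition, because the
    supremum over [X] may equal [e]. *)
Definition near_each (R : realType) (T : Type) (d : T -> T -> R) (e : R)
    (X Y : set T) : Prop :=
  forall x, X x -> exists2 y, Y y & d x y < e.

Lemma near_each_trans (R : realType) (T : Type) (d : T -> T -> R) (a b : R)
    (X Y Z : set T) (d_metric : is_metric d) :
  near_each d a X Y -> near_each d b Y Z -> near_each d (a + b) X Z.
Proof.
case: d_metric => _ _ _ tri XY YZ x /XY[y /YZ[z Zz yz] xy].
by exists z => //; apply: le_lt_trans (tri x y z) _; apply: ltrD.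
Qed.

Lemma near_each_of_d_a_lt (R : realType) (T : Type) (d : T -> T -> R) (e : R)
    (X Y : set T) :
  (d_a d X Y < e%:E)%E -> near_each d e X Y.
Proof.
move=> XY x Xx.
have : (ereal_inf [set (d x y)%:E | y in Y] < e%:E)%E.
  by apply: le_lt_trans XY; apply: ereal_sup_ubound; exists x.
by move=> /ereal_inf_lt[_ [y Yy <-]]; rewrite lte_fin; exists y.
Qed.

Lemma d_a_le_of_near_each (R : realType) (T : Type) (d : T -> T -> R) (e : R)
    (X Y : set T) :
  near_each d e X Y -> (d_a d X Y <= e%:E)%E.
Proof.
move=> XY; apply: ge_ereal_sup => _ [x Xx <-].
have [y Yy xy] := XY x Xx.
apply: (@le_trans _ _ (d x y)%:E); last by rewrite lee_fin ltW.
by apply: ereal_inf_lbound; exists y.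
Qed.

Lemma near_each_of_d_H_lt (R : realType) (T : Type) (d : T -> T -> R) (e : R)
    (X Y : set T) :
  (d_H d X Y < e%:E)%E -> near_each d e X Y /\ near_each d e Y X.
Proof. by rewrite /d_H gt_max => /andP[? ?]; split; apply: near_each_of_d_a_lt. Qed.

Lemma d_H_lt_of_near_each (R : realType) (T : Type) (d : T -> T -> R) (a e : R)
    (X Y : set T) :
  a < e -> near_each d a X Y -> near_each d a Y X -> (d_H d X Y < e%:E)%E.
Proof.
move=> ae XY YX; rewrite -lte_fin in ae; rewrite /d_H gt_max; apply/andP; split;
  by apply: le_lt_trans ae; apply: d_a_le_of_near_each.
Qed.

Lemma nbhs_metric_ball (R : realType) (T : topologicalType) (d : T -> T -> R)
    (x : T) (e : R) (d_top : induces_topology d) :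
  0 < e -> nbhs x [set y | d x y < e].
Proof. by move=> e0; apply/d_top; exists e. Qed.

Lemma joint_continuity_modulus (R : realType) (q : nat) (T : topologicalType)
    (d : T -> T -> R) (d_top : induces_topology d) (M : set 'rV[R]_q)
    (f : 'rV[R]_q -> T -> T)
    (f_cont : {within M `*` setT,
                 continuous (fun z : 'rV[R]_q * T => f z.1 z.2)})
    (mu : 'rV[R]_q) (x : T) (e : R) :
  M mu -> 0 < e ->
  exists2 delta : R, 0 < delta &
    forall nu y, M nu -> `|mu - nu| < delta -> d x y < delta ->
      d (f mu x) (f nu y) < e.
Proof.
move=> Mmu e0.
move/subspace_continuousP: f_cont => /(_ (mu, x) (conj Mmu I)) /=.
move=> /(_ _ (nbhs_metric_ball (f mu x) d_top e0)).
case=> -[U V] /= [/nbhs_ballP[a /= a0 aU] /d_top[b b0 bV]] UV.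
exists (Num.min a b); first by rewrite lt_min a0.
move=> nu y Mnu; rewrite !lt_min => /andP[mn _] /andP[_ xy].
apply: (UV (nu, y)) => //; split => /=; last exact: bV.
by apply: aU; rewrite -ball_normE.
Qed.

(** Unlike uniform continuity on the compact set [K], only [x] is confined to
    [K]: the nearby point [y] may lie outside. *)
Lemma uniform_continuity_near_compact (R : realType) (q : nat)
    (T : topologicalType) (d : T -> T -> R) (d_metric : is_metric d)
    (d_top : induces_topology d) (M : set 'rV[R]_q) (f : 'rV[R]_q -> T -> T)
    (f_cont : {within M `*` setT,
                 continuous (fun z : 'rV[R]_q * T => f z.1 z.2)})
    (mu : 'rV[R]_q) (K : set T) (e : R) :
  M mu -> compact K -> 0 < e ->
  exists2 delta : R, 0 < delta &
    forall x nu y, K x -> M nu -> `|mu - nu| < delta -> d x y < delta ->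
      d (f mu x) (f nu y) < e.
Proof.
move=> Mmu cK e0; have [_ _ sym tri] := d_metric.
have /compact_near_coveringP/(_ R (0:R)^'+
  (fun delta x => forall nu y, M nu -> `|mu - nu| < delta -> d x y < delta ->
      d (f mu x) (f nu y) < e)) := cK.
case.
  move=> x0 _; have e20 : 0 < e / 2 by lra.
  have [c c0 fc] := joint_continuity_modulus d_top f_cont x0 Mmu e20.
  (* The points within c / 2 of x0, with the moduli below c / 2: then both x
     and y lie in the c-ball about x0, and f mu x0 serves as the midpoint. *)
  exists ([set x | d x0 x < c / 2], [set delta | delta < c / 2]).
    split; first by apply: nbhs_metric_ball => //; lra.
    by apply: nbhs_right_lt; lra.
  move=> [x delta] /= [x0x dc] nu y Mnu mn xy.
  have fx : d (f mu x0) (f mu x) < e / 2.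
    by apply: fc => //; rewrite ?subrr ?normr0 //; lra.
  have fy : d (f mu x0) (f nu y) < e / 2.
    apply: fc => //; first by lra.
    by have := tri x0 x y; lra.
  by have := tri (f mu x) (f mu x0) (f nu y); rewrite (sym (f mu x) (f mu x0)); lra.
move=> a /= a0 Ha; exists (a / 2); first by lra.
move=> x nu y Kx Mnu mn xy; apply: (Ha (a / 2)) (Kx) _ _ Mnu mn xy; last by lra.
by rewrite /= sub0r normrN gtr0_norm; lra.
Qed.

Lemma compact_image_section (R : realType) (q : nat) (T : topologicalType)
    (d : T -> T -> R) (d_top : induces_topology d) (M : set 'rV[R]_q)
    (f : 'rV[R]_q -> T -> T)
    (f_cont : {within M `*` setT,
                 continuous (fun z : 'rV[R]_q * T => f z.1 z.2)})
    (mu : 'rV[R]_q) (K : set T) :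
  M mu -> compact K -> compact (f mu @` K).
Proof.
move=> Mmu; apply: continuous_compact.
apply: continuous_subspaceT => x U /d_top[e e0 eU].
have [c c0 fc] := joint_continuity_modulus d_top f_cont x Mmu e0.
apply/d_top; exists c => // y xy; apply: eU.
by apply: fc => //; rewrite subrr normr0.
Qed.

Lemma hausdorff_continuous_image (R : realType) (q : nat)
    (T : topologicalType) (d : T -> T -> R) (d_metric : is_metric d)
    (d_top : induces_topology d) (M : set 'rV[R]_q) (f : 'rV[R]_q -> T -> T)
    (f_cont : {within M `*` setT,
                 continuous (fun z : 'rV[R]_q * T => f z.1 z.2)})
    (S : 'rV[R]_q -> set T) :
  (forall mu, M mu -> compact (S mu)) ->
  hausdorff_continuous d M S ->
  hausdorff_continuous d M (fun mu => f mu @` S mu).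
Proof.
move=> cS hS mu Mmu e e0; have [_ _ sym _] := d_metric.
have e20 : 0 < e / 2 by lra.
have [c c0 fc] := uniform_continuity_near_compact d_metric d_top f_cont
  Mmu (cS mu Mmu) e20.
have [b b0 Sb] := hS mu Mmu c c0.
exists (Num.min b c); first by rewrite lt_min b0.
move=> nu Mnu; rewrite lt_min => /andP[mb mc].
have [mn nm] := near_each_of_d_H_lt (Sb nu Mnu mb).
apply: (@d_H_lt_of_near_each _ _ _ (e / 2)); first by lra.
- move=> _ [x Sx <-]; have [y Sy xy] := mn x Sx.
  by exists (f nu y); [exists y | exact: fc].
- move=> _ [y Sy <-]; have [x Sx yx] := nm y Sy.
  exists (f mu x); first by exists x.
  by rewrite sym; apply: fc => //; rewrite sym.
Qed.

Lemma image_iterS (T : Type) (g : T -> T) (n : nat) (X : set T) :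
  iter n.+1 g @` X = g @` (iter n g @` X).
Proof. by rewrite -image_comp. Qed.

Lemma hausdorff_continuous_iter (R : realType) (q : nat)
    (T : topologicalType) (d : T -> T -> R) (d_metric : is_metric d)
    (d_top : induces_topology d) (M : set 'rV[R]_q) (f : 'rV[R]_q -> T -> T)
    (f_cont : {within M `*` setT,
                 continuous (fun z : 'rV[R]_q * T => f z.1 z.2)})
    (S : 'rV[R]_q -> set T) (n : nat) :
  (forall mu, M mu -> compact (S mu)) ->
  hausdorff_continuous d M S ->
  hausdorff_continuous d M (fun mu => iter n (f mu) @` S mu).
Proof.
move=> cS hS.
(* Compactness is carried along, since the image step needs it at each stage. *)
suff [] : (forall mu, M mu -> compact (iter n (f mu) @` S mu)) /\
    hausdorff_continuous d M (fun mu => iter n (f mu) @` S mu) by [].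
elim: n => [|n [cn hn]].
  have iter0 mu : iter 0 (f mu) @` S mu = S mu by exact: image_id.
  split=> [mu Mmu|]; first by rewrite iter0; apply: cS.
  by rewrite (funext iter0).
split=> [mu Mmu|].
  by rewrite image_iterS; apply: compact_image_section Mmu (cn mu Mmu).
have -> : (fun mu => iter n.+1 (f mu) @` S mu) =
    (fun mu => f mu @` (iter n (f mu) @` S mu)).
  by apply/funext => mu; exact: image_iterS.
exact: hausdorff_continuous_image.
Qed.

(** Both [A mu] and [A nu] are compared with [S n mu] and [S n nu] for one [n]
    that serves all parameters, so the choice of [n] precedes that of [nu]. *)
Lemma hausdorff_continuous_uniform_limit (R : realType) (q : nat) (T : Type)
    (d : T -> T -> R) (d_metric : is_metric d) (M : set 'rV[R]_q)
    (S : nat -> 'rV[R]_q -> set T) (A : 'rV[R]_q -> set T) :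
  (forall n, hausdorff_continuous d M (S n)) ->
  (forall e : R, 0 < e ->
     exists n0 : nat, forall n, (n0 <= n)%N -> forall mu, M mu ->
       (d_H d (S n mu) (A mu) < e%:E)%E) ->
  hausdorff_continuous d M A.
Proof.
move=> hS SA mu Mmu e e0.
(* Quarters, because passing back from pointwise bounds to d_H loses the
   strict inequality. *)
have e40 : 0 < e / 4 by lra.
have [n Sn] := SA _ e40.
have [c c0 hc] := hS n mu Mmu _ e40.
exists c => // nu Mnu mn.
have [S_Amu Amu_S] := near_each_of_d_H_lt (Sn n (leqnn n) mu Mmu).
have [S_Anu Anu_S] := near_each_of_d_H_lt (Sn n (leqnn n) nu Mnu).
have [mu_nu nu_mu] := near_each_of_d_H_lt (hc nu Mnu mn).
apply: (@d_H_lt_of_near_each _ _ _ (e / 4 + (e / 4 + e / 4))); first by lra.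
- exact: near_each_trans d_metric Amu_S (near_each_trans d_metric mu_nu S_Anu).
- exact: near_each_trans d_metric Anu_S (near_each_trans d_metric nu_mu S_Amu).
Qed.

Unset Implicit Arguments.
Set Strict Implicit.

Theorem theorem5p2 (R : realType) (p q : nat)
    (d : 'rV[R]_p -> 'rV[R]_p -> R)
    (d_metric : is_metric d)
    (d_top : induces_topology d)
    (M : set 'rV[R]_q)
    (M_compact : compact M)
    (f : 'rV[R]_q -> 'rV[R]_p -> 'rV[R]_p)
    (f_cont : {within M `*` setT,
                 continuous (fun z : 'rV[R]_q * 'rV[R]_p => f z.1 z.2)})
    (A : 'rV[R]_q -> set 'rV[R]_p)
    (A_attractor : forall mu, M mu -> is_attractor d (f mu) (A mu))
    (r : 'rV[R]_q -> R)
    (r_gt0 : forall mu, M mu -> 0 < r mu)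
    (r_attracts : forall mu, M mu -> attracts d (f mu) (A mu) (r mu))
    (Omega : set 'rV[R]_p)
    (Omega_compact : compact Omega)
    (basin_Omega : forall mu, M mu -> nbhd d (r mu) (A mu) `<=` Omega)
    (N : 'rV[R]_q -> set 'rV[R]_p)
    (N_compact : forall mu, M mu -> compact (N mu))
    (N_Omega : forall mu, M mu -> N mu `<=` Omega)
    (N_cont : hausdorff_continuous d M N)
    (N_forward : forall mu, M mu -> f mu @` N mu `<=` N mu)
    (A_eq : forall mu, M mu ->
       A mu = closure (\bigcap_n (iter n (f mu) @` N mu)))
    (unif_cvg : forall e : R, 0 < e ->
       exists n0 : nat, forall n, (n0 <= n)%N -> forall mu, M mu ->
         (d_H d (iter n (f mu) @` N mu) (A mu) < e%:E)%E) :
  hausdorff_continuous d M A.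
Proof.
apply: (@hausdorff_continuous_uniform_limit _ _ _ _ d_metric M
  (fun n mu => iter n (f mu) @` N mu) A _ unif_cvg) => n.
exact: (hausdorff_continuous_iter d_metric d_top f_cont n N_compact N_cont).
Qed.
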